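(* The category $\mathbf{S}$ of abstract spectra and their morphisms and the category $\mathbf{CohSp}$ of coherent spaces and coherent maps are isomorphic, i.e. there exist covariant functors $F:\mathbf{S}\to\mathbf{CohSp}$ and $G:\mathbf{CohSp}\to\mathbf{S}$ with $F\circ G=\mathrm{Id}_{\mathbf{CohSp}}$ and $G\circ F=\mathrm{Id}_{\mathbf{S}}$.
   Context: Compact means that every open cover has a finite subcover (no separation axiom is included). A bitopological space $(S,\mathcal{T}^+,\mathcal{T}^-)$ is a set $S$ with two topologies. Put $\mathcal{L}^+=\{U\in\mathcal{T}^+: S\setminus U\in\mathcal{T}^-\}$ and $\mathcal{L}^-=\{U\in\mathcal{T}^-: S\setminus U\in\mathcal{T}^+\}$. A non-empty bitopological space $(S,\mathcal{T}^+,\mathcal{T}^-)$ is an abstract spectrum if: (SP1) $\mathcal{L}^+$ is a base for $\mathcal{T}^+$ and $\mathcal{L}^-$ is a base for $\mathcal{T}^-$; (SP2) if $F\subseteq S$ and $S\setminus F\in\mathcal{T}^+$ (resp. $S\setminus F\in\mathcal{T}^-$) then $F$ is a compact subset of $(S,\mathcal{T}^-)$ (resp. of $(S,\mathcal{T}^+)$); (SP3) at least one of $(S,\mathcal{T}^+)$, $(S,\mathcal{T}^-)$ is a $T_0$-space. The category $\mathbf{S}$ has abstract spectra as objects; an $\mathbf{S}$-morphism $(S_1,\mathcal{T}_1^+,\mathcal{T}_1^-)\to(S_2,\mathcal{T}_2^+,\mathcal{T}_2^-)$ is a function $f:S_1\to S_2$ that is continuous both as a map $(S_1,\mathcal{T}_1^+)\to(S_2,\mathcal{T}_2^+)$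 and as a map $(S_1,\mathcal{T}_1^-)\to(S_2,\mathcal{T}_2^-)$; composition is the usual one. For a topological space $X$ let $KO(X)$ be the family of all compact open subsets of $X$. A closed subset $F$ of $X$ is irreducible if $F=F_1\cup F_2$ with $F_1,F_2$ closed in $X$ implies $F=F_1$ or $F=F_2$. $X$ is sober if it is $T_0$ and every non-empty irreducible subset is the closure of a point. $X$ is coherent if it is a compact sober space and $KO(X)$ is a base of its topology closed under finite intersections. A continuous map $f:X'\to X''$ is coherent if $U\in KO(X'')$ implies $f^{-1}(U)\in KO(X')$. $\mathbf{CohSp}$ is the category of all coherent spaces and all coherent maps between them.
   Formalization: Coherent spaces are required to be non-empty here: if the empty space counts as coherent, it is an initial object of CohSp, while S, whose objects are non-empty, has no initial object, so the claim would fail. *)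

(* Defs.v *)
From HB Require Import structures.
From mathcomp Require Import all_boot all_classical topology.

Set Implicit Arguments.
Unset Strict Implicit.
Unset Printing Implicit Defensive.

Local Open Scope classical_set_scope.

(* Topologies on a bare type. A topologicalType also carries a choice
   structure, which would become part of the identity of an object; here a
   topology is determined by its family of open sets only. *)
Record topology (T : Type) := Topology {
  opens : set (set T) ;
  opensT : opens [set: T] ;
  opensI : setI_closed opens ;
  opens_bigcup : forall A : set (set T),
    A `<=` opens -> opens (\bigcup_(U in A) U)
}.

Definition space (T : Type) (t : topology T) : Type := T.

Section SpaceTopology.
Variables (T : Type) (t : topology T).

HB.instance Definition _ := gen_eqMixin (space t).
HB.instance Definition _ := gen_choiceMixin (space t).

Let opens_bigU (I : Type) (f : I -> set (space t)) :
  (forall i, opens t (f i)) -> opens t (\bigcup_i f i).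
Proof.
move=> fo; have -> : \bigcup_i f i = \bigcup_(U in range f) U.
  by rewrite bigcup_image.
by apply: opens_bigcup => _ [i _ <-]; exact: fo.
Qed.

HB.instance Definition _ := isOpenTopological.Build (space t)
  (@opensT T t) (@opensI T t) opens_bigU.

Lemma open_spaceE : (open : set (set (space t))) = opens t.
Proof. by []. Qed.

End SpaceTopology.

(* Compactness is the open-cover property, cover_compact. *)
Definition KO (X : topologicalType) : set (set X) :=
  [set U | open U /\ cover_compact U].

Definition irreducible_closed (X : topologicalType) (F : set X) : Prop :=
  closed F /\
  forall F1 F2 : set X, closed F1 -> closed F2 ->
    F = F1 `|` F2 -> F = F1 \/ F = F2.

Definition sober (X : topologicalType) : Prop :=
  kolmogorov_space X /\
  forall F : set X, irreducible_closed F -> F !=set0 ->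
    exists x : X, F = closure [set x].

(* Spaces are taken to be non-empty, as abstract spectra are: the empty space
   is not the first topology of any abstract spectrum. The intersection of the
   empty family is the whole space, whose membership in KO X is the
   compactness of X, so binary intersections suffice in the last clause. *)
Definition is_coherent (X : topologicalType) : Prop :=
  [/\ [set: X] !=set0, cover_compact [set: X], sober X,
      basis (@KO X) & setI_closed (@KO X)].

Definition coherent_map (X Y : topologicalType) (f : X -> Y) : Prop :=
  continuous f /\ forall U : set Y, KO U -> KO (f @^-1` U).

Record bitopSpace := BitopSpace {
  bipoint :> Type ;
  tpos : topology bipoint ;
  tneg : topology bipoint
}.

Definition Lpos (S : bitopSpace) : set (set S) :=
  [set U | opens (tpos S) U /\ opens (tneg S) (~` U)].

Definition Lneg (S : bitopSpace) : set (set S) :=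
  [set U | opens (tneg S) U /\ opens (tpos S) (~` U)].

Definition SP1 (S : bitopSpace) : Prop :=
  @basis (space (tpos S)) (@Lpos S) /\ @basis (space (tneg S)) (@Lneg S).

Definition SP2 (S : bitopSpace) : Prop :=
  (forall F : set S, opens (tpos S) (~` F) -> @cover_compact (space (tneg S)) F) /\
  (forall F : set S, opens (tneg S) (~` F) -> @cover_compact (space (tpos S)) F).

Definition SP3 (S : bitopSpace) : Prop :=
  kolmogorov_space (space (tpos S)) \/ kolmogorov_space (space (tneg S)).

Definition is_abstract_spectrum (S : bitopSpace) : Prop :=
  [/\ [set: S] !=set0, SP1 S, SP2 S & SP3 S].

Definition bicontinuous (S1 S2 : bitopSpace) (f : S1 -> S2) : Prop :=
  continuous (f : space (tpos S1) -> space (tpos S2)) /\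
  continuous (f : space (tneg S1) -> space (tneg S2)).

Record category := Category {
  obj :> Type ;
  hom : obj -> obj -> Type ;
  idm : forall X, hom X X ;
  compm : forall X Y Z, hom Y Z -> hom X Y -> hom X Z ;
  compm1 : forall X Y (f : hom X Y), compm f (idm X) = f ;
  comp1m : forall X Y (f : hom X Y), compm (idm Y) f = f ;
  compmA : forall X Y Z W (h : hom Z W) (g : hom Y Z) (f : hom X Y),
    compm h (compm g f) = compm (compm h g) f
}.

Record functor (C D : category) := Functor {
  fobj :> C -> D ;
  fhom : forall X Y : C, hom X Y -> hom (fobj X) (fobj Y) ;
  fhom1 : forall X : C, fhom (idm X) = idm (fobj X) ;
  fhomM : forall (X Y Z : C) (g : hom Y Z) (f : hom X Y),
    fhom (compm g f) = compm (fhom g) (fhom f)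
}.

Definition functor_id (C : category) : functor C C :=
  @Functor C C id (fun _ _ f => f) (fun _ => erefl) (fun _ _ _ _ _ => erefl).

Lemma functor_comp1 (C D E : category) (G : functor D E) (F : functor C D)
  (X : C) : fhom G (fhom F (idm X)) = idm (G (F X)).
Proof. by rewrite !fhom1. Qed.

Lemma functor_compM (C D E : category) (G : functor D E) (F : functor C D)
    (X Y Z : C) (g : hom Y Z) (f : hom X Y) :
  fhom G (fhom F (compm g f)) = compm (fhom G (fhom F g)) (fhom G (fhom F f)).
Proof. by rewrite !fhomM. Qed.

Definition functor_comp (C D E : category)
    (G : functor D E) (F : functor C D) : functor C E :=
  @Functor C E (fun X => G (F X)) (fun _ _ f => fhom G (fhom F f))
    (functor_comp1 G F) (@functor_compM C D E G F).

Record spectrum := Spectrum {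
  spectrum_space :> bitopSpace ;
  spectrumP : is_abstract_spectrum spectrum_space
}.

Definition spectrum_hom (S1 S2 : spectrum) : Type :=
  {f : S1 -> S2 | bicontinuous f}.

Lemma bicontinuous_id (S : bitopSpace) : bicontinuous (@id S).
Proof. by split=> x; exact: cvg_id. Qed.

Lemma bicontinuous_comp (S1 S2 S3 : bitopSpace) (g : S2 -> S3) (f : S1 -> S2) :
  bicontinuous g -> bicontinuous f -> bicontinuous (g \o f).
Proof.
move=> [gp gn] [fp fn].
by split=> x; [exact: (continuous_comp (fp x) (gp _))
             | exact: (continuous_comp (fn x) (gn _))].
Qed.

Definition spectrum_id (S : spectrum) : spectrum_hom S S :=
  exist _ id (bicontinuous_id S).

Definition spectrum_comp (S1 S2 S3 : spectrum)
    (g : spectrum_hom S2 S3) (f : spectrum_hom S1 S2) : spectrum_hom S1 S3 :=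
  exist _ (sval g \o sval f) (bicontinuous_comp (svalP g) (svalP f)).

Definition AbstractSpectra : category.
Proof.
refine (@Category spectrum spectrum_hom spectrum_id spectrum_comp _ _ _).
- by move=> X Y [f fP]; exact: eq_exist.
- by move=> X Y [f fP]; exact: eq_exist.
- by move=> X Y Z W h g f; exact: eq_exist.
Defined.

Record cohSpace := CohSpace {
  cohpoint :> Type ;
  cohtop : topology cohpoint ;
  cohSpaceP : is_coherent (space cohtop)
}.

Definition coh_hom (X Y : cohSpace) : Type :=
  {f : X -> Y | @coherent_map (space (cohtop X)) (space (cohtop Y)) f}.

Lemma coherent_map_id (X : topologicalType) : coherent_map (@id X).
Proof. by split=> // x; exact: cvg_id. Qed.

Lemma coherent_map_comp (X Y Z : topologicalType) (g : Y -> Z) (f : X -> Y) :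
  coherent_map g -> coherent_map f -> coherent_map (g \o f).
Proof.
move=> [gc gK] [fc fK]; split=> [x|U KU].
  exact: (continuous_comp (fc x) (gc _)).
by rewrite comp_preimage; exact/fK/gK.
Qed.

Definition coh_id (X : cohSpace) : coh_hom X X :=
  exist _ id (@coherent_map_id (space (cohtop X))).

Definition coh_comp (X Y Z : cohSpace)
    (g : coh_hom Y Z) (f : coh_hom X Y) : coh_hom X Z :=
  exist _ (sval g \o sval f) (coherent_map_comp (svalP g) (svalP f)).

Definition CohSp : category.
Proof.
refine (@Category cohSpace coh_hom coh_id coh_comp _ _ _).
- by move=> X Y [f fP]; exact: eq_exist.
- by move=> X Y [f fP]; exact: eq_exist.
- by move=> X Y Z W h g f; exact: eq_exist.
Defined.

(* Main.v *)
From mathcomp Require Import all_boot finmap all_classical topology.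
Require Import Defs.

(** Both functors are the identity on underlying functions: F forgets the second
topology, and G adds the topology generated by the complements of compact open
sets. On an abstract spectrum L^+ is exactly the family of compact open sets of
T^+, so T^- is recovered from T^+. Given a non-empty T^+-closed irreducible Z,
the sets in L^- not containing Z form a directed family; Z is T^--compact, so
they do not cover Z, and any point they miss is generic: T^+ is sober.
Conversely, in a coherent space a closed set C meeting every member of a family
of compact open sets stable under finite intersections meets their
intersection: by Zorn, C shrinks to a minimal such set, which is irreducible,
and its generic point lies in every member. This gives (SP2). *)

Set Implicit Arguments.
Unset Strict Implicit.
Unset Printing Implicit Defensive.

Local Open Scope classical_set_scope.

(** * Compactness through covers stable under unions, compact open sets, bases *)

Lemma cover_compactP (X : topologicalType) (A : set X) :
  cover_compact A <->
  forall D : set (set X), D `<=` open -> D !=set0 -> setU_closed D ->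
    A `<=` \bigcup_(U in D) U -> exists2 U, D U & A `<=` U.
Proof.
split=> [cA D Do [U0 DU0] DU AD|dA I D f fo Af].
  have [E ED AE] := cA _ D id Do AD.
  suff [V DV EV] : exists2 V, D V & cover [set` E] id `<=` V.
    by exists V => //; exact: subset_trans EV.
  move: E ED {AE}; apply: finSet_rect => E IH ED.
  have [->|[U UE]] := fset_0Vmem E; first by exists U0 => // x [].
  have [||V DV EV] := IH (E `\ U)%fset; first exact: fproperD1.
    by move=> W; rewrite in_fsetD1 => /andP[_ /ED].
  exists (U `|` V); first by apply: DU => //; exact/set_mem/ED.
  move=> x [W /= WE Wx]; have [WU|WU] := eqVneq W U; first by left; rewrite -WU.
  by right; apply: EV; exists W => //=; rewrite in_fsetD1 WU.
(* The finite unions of the given cover are stable under binary unions, so a single one of them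
   contains [A]. *)
pose D1 := [set cover [set` E] f | E in [set E : {fset I} | {subset E <= D}]].
have [||||_ [E ED <-] AE] := dA D1.
- move=> _ [E ED <-]; apply: bigcup_open => i /ED; rewrite inE; exact: fo.
- by exists (cover [set` fset0] f), fset0.
- move=> _ _ [E1 ED1 <-] [E2 ED2 <-]; exists (E1 `|` E2)%fset.
    by move=> i; rewrite in_fsetU => /orP[/ED1|/ED2].
  by rewrite /cover -bigcup_setU; congr (\bigcup_(i in _) f i); rewrite set_fsetU.
- move=> x /Af [i Di fi_x]; exists (cover [set` [fset i]%fset] f).
    exists [fset i]%fset => // j; rewrite in_fset1 => /eqP ->; exact/mem_set.
  by exists i => //=; rewrite in_fset1.
by exists E.
Qed.

Lemma KO0 (X : topologicalType) : @KO X set0.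
Proof.
by split; [exact: open0 | apply/cover_compactP => D _ [U DU] _ _; exists U].
Qed.

Lemma KOU (X : topologicalType) : setU_closed (@KO X).
Proof.
move=> U V [oU /cover_compactP cU] [oV /cover_compactP cV].
split; first exact: openU.
apply/cover_compactP => D Do D0 DU; rewrite subUset => -[UD VD].
have [U' DU' UU'] := cU D Do D0 DU UD.
have [V' DV' VV'] := cV D Do D0 DU VD.
by exists (U' `|` V'); [exact: DU | exact: setUSS].
Qed.

Lemma basis_openP (X : topologicalType) (B : set (set X)) (U : set X) :
  basis B -> open U -> forall x, U x -> exists V, [/\ B V, V x & V `<=` U].
Proof.
move=> [_ Bb] oU x Ux; have [|V [BV Vx] VU] := Bb x U; first exact: open_nbhs_nbhs.
by exists V.
Qed.

Lemma open_basis (X : topologicalType) (B : set (set X)) :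
  B `<=` open ->
  (forall U x, open U -> U x -> exists V, [/\ B V, V x & V `<=` U]) -> basis B.
Proof.
move=> Bo BU; split=> // x A; rewrite nbhsE => -[U [oU Ux] UA].
have [V [BV Vx VU]] := BU U x oU Ux.
by exists V => //; exact: subset_trans UA.
Qed.

Lemma kolmogorov_openP (X : topologicalType) :
  kolmogorov_space X <->
  forall x y : X, x <> y ->
    exists2 U : set X, open U & (U x /\ ~ U y) \/ (U y /\ ~ U x).
Proof.
split=> kX x y.
  move=> /eqP/kX [A]; rewrite !inE !nbhsE /=.
  by move=> -[[[U [oU Ux] UA] nA]|[[U [oU Ux] UA] nA]]; exists U => //;
    [left|right]; split => // /UA.
move=> /eqP/kX [U oU xy]; exists U; rewrite !inE /=.
by case: xy => -[Ux nUy]; [left|right]; split => //; exact: open_nbhs_nbhs.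
Qed.

Lemma topology_eq (T : Type) (t1 t2 : topology T) :
  opens t1 = opens t2 -> t1 = t2.
Proof.
case: t1 t2 => [o1 p1 q1 r1] [o2 p2 q2 r2] /= E; case: _ / E p2 q2 r2 => p2 q2 r2.
by congr Topology; exact: Prop_irrelevance.
Qed.

(** * The topology generated by the complements of compact open sets *)

Section CoKO.
Variables (T : Type) (t : topology T).

(** Complements of compact open sets are stable under binary intersections and thus form a base, so
    one of them around each point suffices. *)
Definition coKO_open : set (set T) := [set V | forall x, V x ->
  exists U, [/\ @KO (space t) U, ~ U x & ~` U `<=` V]].

Lemma coKO_openT : coKO_open [set: T].
Proof. by move=> x _; exists set0; split => //; exact: (@KO0 (space t)). Qed.

Lemma coKO_openI : setI_closed coKO_open.
Proof.
move=> V W oV oW x [/oV [A [KA nA AV]] /oW [B [KB nB BW]]].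
exists (A `|` B); split; first exact: (@KOU (space t)).
  by case.
by rewrite setCU; exact: setISS.
Qed.

Lemma coKO_open_bigcup (A : set (set T)) :
  A `<=` coKO_open -> coKO_open (\bigcup_(U in A) U).
Proof.
move=> Ao x [V AV Vx]; have [U [KU nU UV]] := Ao V AV x Vx.
by exists U; split => // y /UV Vy; exists V.
Qed.

Definition coKO_topology := Topology coKO_openT coKO_openI coKO_open_bigcup.

Lemma coKO_openC (U : set T) : @KO (space t) U -> coKO_open (~` U).
Proof. by move=> KU x nU; exists U; split. Qed.

End CoKO.

(** * From abstract spectra to coherent spaces *)

Section SpectrumCoherent.
Variable S : bitopSpace.
Hypothesis SP : is_abstract_spectrum S.

Let SP1p : forall U, opens (tpos S) U -> forall x, U x ->
  exists V, [/\ Lpos V, V x & V `<=` U].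
Proof.
by move=> U oU; case: SP => _ [b _] _ _; exact: (@basis_openP (space (tpos S))).
Qed.

Let SP1n : forall U, opens (tneg S) U -> forall x, U x ->
  exists V, [/\ Lneg V, V x & V `<=` U].
Proof.
by move=> U oU; case: SP => _ [_ b] _ _; exact: (@basis_openP (space (tneg S))).
Qed.

Lemma Lpos0 : @Lpos S set0.
Proof.
by split; [exact: (@open0 (space (tpos S))) | rewrite setC0; exact: opensT].
Qed.

Lemma LposT : @Lpos S setT.
Proof.
by split; [exact: opensT | rewrite setCT; exact: (@open0 (space (tneg S)))].
Qed.

Lemma LposU : setU_closed (@Lpos S).
Proof.
move=> U V [oU cU] [oV cV]; split; first exact: (@openU (space (tpos S))).
by rewrite setCU; exact: opensI.
Qed.

Lemma LposI : setI_closed (@Lpos S).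
Proof.
move=> U V [oU cU] [oV cV]; split; first exact: opensI.
by rewrite setCI; exact: (@openU (space (tneg S))).
Qed.

(** (SP2) makes members of [Lpos] compact. Conversely, the members of [Lpos] inside a compact open
    [U] cover it and are stable under unions, so one of them is [U]. *)
Lemma KO_tpos : @KO (space (tpos S)) = @Lpos S.
Proof.
apply/seteqP; split=> U; last first.
  by move=> [oU cU]; split=> //; case: SP => _ _ [_ +] _; exact.
move=> [oU /cover_compactP cU].
have [||||V [LV VU] UV] := cU [set V | Lpos V /\ V `<=` U].
- by move=> V [[]].
- by exists set0; split => //; exact: Lpos0.
- move=> V W [LV VU] [LW WU]; split; first exact: LposU.
  by rewrite subUset.
- by move=> x /(SP1p oU) [V [LV Vx VU]]; exists V.
by have -> : U = V by apply/seteqP.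
Qed.

(** Complements of members of [Lneg] are open in [tpos], so a basic set separating two points for
    [tneg] yields one separating them for [tpos] in the opposite order. *)
Lemma tpos_kolmogorov : kolmogorov_space (space (tpos S)).
Proof.
case: SP => _ _ _ [//|/kolmogorov_openP k]; apply/kolmogorov_openP => x y /k.
move=> [U oU [[Ux nUy]|[Uy nUx]]].
- have [V [[_ cV] Vx VU]] := SP1n oU Ux; exists (~` V) => //.
  by right; split=> [/VU|].
- have [V [[_ cV] Vy VU]] := SP1n oU Uy; exists (~` V) => //.
  by left; split=> [/VU|].
Qed.

Lemma tpos_sober : sober (space (tpos S)).
Proof.
split; first exact: tpos_kolmogorov.
move=> F [cF irrF] F0.
have cpF : @cover_compact (space (tneg S)) F.
  by case: SP => _ _ [+ _] _; apply; exact: (@closed_openC (space (tpos S))).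
move/cover_compactP : cpF => cpF.
pose D := [set V : set S | Lneg V /\ ~ F `<=` V].
have [x Fx nDx] : exists2 x, F x & ~ (\bigcup_(V in D) V) x.
  apply: contrapT => nx.
  have [||||V [_ FV] /FV //] := cpF D.
  - by move=> V [[]].
  - exists set0; split; last by rewrite subset0; apply/eqP/set0P.
    split; first exact: (@open0 (space (tneg S))).
    by rewrite setC0; exact: opensT.
  - move=> V W [[oV cV] FV] [[oW cW] FW]; split.
      split; first exact: (@openU (space (tneg S))).
      by rewrite setCU; exact: opensI.
    (* [F] would be the union of its traces on [V] and [W], both closed in [tpos], hence equal to
       one of them. *)
    move=> FVW; have [||||] := irrF (F `&` V) (F `&` W).
    + by apply: closedI => //; rewrite -openC.
    + by apply: closedI => //; rewrite -openC.
    + by rewrite -setIUr; apply/esym/setIidPl.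
    + by move/esym/setIidPl.
    + by move/esym/setIidPl.
  - by move=> x Fx; apply: contrapT => nDx; apply: nx; exists x.
exists x; apply/seteqP; split=> [y Fy B|y].
  rewrite nbhsE => -[U [oU Uy] UB]; exists x; split => //; apply: UB.
  (* If [V] missed [x], its complement would contain [x] and belong to [D], since it omits the point
     [y] of [F]. *)
  have [V [[oV cV] Vy VU]] := SP1p oU Uy; apply: VU; apply: contrapT => nVx.
  apply: nDx; exists (~` V) => //; split; first by split; rewrite ?setCK.
  by move/(_ y Fy).
by move/(@closureS (space (tpos S)) _ F); rewrite sub1set inE => /(_ Fx); exact: cF.
Qed.

Lemma tpos_coherent : is_coherent (space (tpos S)).
Proof.
split; first by case: SP.
- by have := LposT; rewrite -KO_tpos => -[].
- exact: tpos_sober.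
- by rewrite KO_tpos; case: SP => _ [].
- rewrite KO_tpos; exact: LposI.
Qed.

(** By [KO_tpos] the complements of compact open sets are the members of [Lneg], a base of
    [tneg]. *)
Lemma coKO_tpos : coKO_topology (tpos S) = tneg S.
Proof.
apply: topology_eq => /=; apply/seteqP; split=> V oV; last first.
  move=> x /(SP1n oV) [W [[oW cW] Wx WV]]; exists (~` W).
  by rewrite KO_tpos setCK; split => //; split; rewrite ?setCK.
have -> : V = \bigcup_(W in [set W | opens (tneg S) W /\ W `<=` V]) W.
  apply/seteqP; split=> [x /oV [U []]|x [W [_]]]; last exact.
  by rewrite KO_tpos => -[_ cU] nU UV; exists (~` U).
by apply: opens_bigcup => W [].
Qed.

End SpectrumCoherent.

(** * From coherent spaces to abstract spectra *)

Section CoherentSpectrum.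

Lemma KO_meet (X : topologicalType) (C : set X) (A : set (set X)) :
  sober X -> closed C -> A `<=` @KO X -> A !=set0 -> setI_closed A ->
  (forall U, A U -> C `&` U !=set0) -> C `&` \bigcap_(U in A) U !=set0.
Proof.
move=> [_ sobX] cC AKO [A0 AA0] AI CA.
(* Zorn enlarges the open set [O] removed from [C], as long as the rest of [C] still meets every
   member of [A]. *)
pose P := [set O : set X | open O /\ forall U, A U -> ~ U `<=` ~` C `|` O].
have [O [[oO AO] maxO]] : exists O, P O /\ forall B, O `<` B -> ~ P B.
  apply: Zorn_bigcup => F FP totF; split; first by apply: bigcup_open => V /FP [].
  move=> U AU UF; have [_ /cover_compactP cU] := AKO U AU.
  (* Compactness of [U] reduces the union of the chain to a single [W]. Allowing [set0] keeps the
     cover non-empty when the chain is empty. *)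
  have [||||_ [W + <-] UW] :=
      cU [set ~` C `|` W | W in [set W | W = set0 \/ F W]].
  - move=> _ [W + <-] => -[->|/FP []]; first by rewrite setU0; exact: closed_openC.
    by move=> oW _; apply: openU => //; exact: closed_openC.
  - by exists (~` C `|` set0), set0 => //; left.
  - move=> _ _ [V FV <-] [W FW <-]; exists (V `|` W); last by rewrite setUUr.
    case: FV FW => [->|FV]; first by rewrite set0U.
    move=> [->|FW]; first by rewrite setU0; right.
    by right; case: (totF V W FV FW) => [/setUidPr ->|/setUidPl ->].
  - move=> x /UF [nCx|[W FW Wx]].
      by exists (~` C `|` set0); [exists set0; [left|] | left].
    by exists (~` C `|` W); [exists W => //; right | right].
  move=> [W0|/FP[_ /(_ _ AU)]//]; have [x [Cx Ux]] := CA U AU.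
  by case: (UW x Ux) => //; rewrite W0.
pose Z := ~` (~` C `|` O).
have cZ : closed Z by rewrite closedC; apply: openU => //; exact: closed_openC.
have meets U : A U -> exists2 x, U x & Z x.
  move=> AU; apply: contrapT => nx; apply: (AO U AU) => x Ux.
  by apply: contrapT => Zx; apply: nx; exists x.
(* If [F] met every member of [A], its complement would satisfy [P] and strictly contain [O]. *)
have shrink F : closed F -> F `<=` Z -> F <> Z -> exists2 U, A U & U `&` F = set0.
  move=> cF FZ nFZ; apply: contrapT => nU; apply: (maxO (~` F)).
    split=> [x Ox Fx|OF]; first by apply: (FZ x Fx); right.
    apply: nFZ; apply/seteqP; split=> // x Zx; apply: contrapT => nFx.
    by apply: Zx; right; exact: OF.
  split; first exact: closed_openC.
  move=> U AU UF; apply: nU; exists U => //; rewrite -subset0 => x [Ux Fx].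
  case: (UF x Ux) => // nCx; apply: (FZ x Fx); exact: or_introl.
have irrZ : irreducible_closed Z.
  split=> // F1 F2 cF1 cF2 ZF; apply: contrapT => /not_orP [/nesym n1 /nesym n2].
  (* Two members of [A] avoiding [F1] and [F2] would have an intersection in [A] that avoids [Z]. *)
  have [|U1 AU1 U1F] := shrink F1 cF1 _ n1; first by rewrite ZF; exact: subsetUl.
  have [|U2 AU2 U2F] := shrink F2 cF2 _ n2; first by rewrite ZF; exact: subsetUr.
  have [x [U1x U2x]] := meets _ (AI _ _ AU1 AU2).
  rewrite ZF => -[F1x|F2x].
    by move: U1F; rewrite -subset0 => /(_ x); apply.
  by move: U2F; rewrite -subset0 => /(_ x); apply.
have [|x Zx] := sobX Z irrZ; first by have [z _ Zz] := meets A0 AA0; exists z.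
exists x; split.
  have : Z x by rewrite Zx; exact: subset_closure.
  by move/not_orP => [/contrapT].
move=> U AU; have [y Uy] := meets U AU; rewrite Zx => /(_ U) [|_ [-> //]].
by apply: open_nbhs_nbhs; split => //; have [] := AKO U AU.
Qed.

Variables (T : Type) (t : topology T).
Hypothesis coh : is_coherent (space t).

Let S := BitopSpace t (coKO_topology t).

Let KO_subLpos : @KO (space t) `<=` @Lpos S.
Proof. by move=> U KU; split; [case: KU | exact: coKO_openC]. Qed.

Let KOT : @KO (space t) setT.
Proof. by split; [exact: openT | case: coh]. Qed.

Lemma coKO_SP1 : SP1 S.
Proof.
split; apply: open_basis => [U []//|U x oU Ux].
  have [_ _ _ bKO _] := coh; have [V [KV Vx VU]] := basis_openP bKO oU Ux.
  by exists V; split => //; exact: KO_subLpos.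
have [V [KV nVx VU]] := oU x Ux; exists (~` V); split => //; split.
  exact: coKO_openC.
by rewrite setCK; case: KV.
Qed.

Lemma coKO_SP2 : SP2 S.
Proof.
have [_ _ sob _ KI] := coh; split=> F oF; apply/cover_compactP => D Do [V0 DV0] DU FD.
  (* Here [F] is closed for [t]. A point of [F] common to all of [A] avoids every [V] in [D], each
     being a union of complements of members of [A]. *)
  pose A := [set U : set T | @KO (space t) U /\ exists2 V, D V & ~` U `<=` V].
  apply: contrapT => nV; have [|||||x [Fx Ax]] := @KO_meet (space t) F A sob.
  - by rewrite -openC.
  - by move=> U [].
  - by exists setT; split => //; exists V0 => //; rewrite setCT.
  - move=> U V [KU [U' DU' UU']] [KV [V' DV' VV']]; split; first exact: KI.
    by exists (U' `|` V'); [exact: DU | rewrite setCI; exact: setUSS].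
  - move=> U [KU [V DV UV]]; apply: contrapT => nFU; apply: nV; exists V => //.
    by move=> x Fx; apply: UV => Ux; apply: nFU; exists x.
  have [V DV Vx] := FD x Fx; have [U [KU nUx UV]] := Do V DV x Vx.
  by apply: nUx; apply: Ax; split => //; exists V.
(* Now [F] is closed for [coKO_topology t], so it is the intersection of [A]. A [U] in [A] covered
   by [D] would, by compactness, lie in one member of [D], and [F] with it. *)
pose A := [set U : set T | @KO (space t) U /\ F `<=` U].
apply: contrapT => nV.
have [|||||x [nDx Ax]] :=
    @KO_meet (space t) (~` (\bigcup_(V in D) V)) A sob.
- by rewrite closedC; exact: bigcup_open.
- by move=> U [].
- by exists setT; split.
- move=> U V [KU FU] [KV FV]; split; first exact: KI.
  by rewrite subsetI.
- move=> U [[_ /cover_compactP cU] FU]; apply: contrapT => nU; apply: nV.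
  have [|V DV UV] := cU D Do (ex_intro _ V0 DV0) DU.
    by move=> x Ux; apply: contrapT => nDx; apply: nU; exists x.
  by exists V => //; exact: subset_trans UV.
have Fx : F x.
  apply: contrapT => /oF [U [KU nUx FU]]; apply: nUx; apply: Ax; split => //.
  by rewrite -[F]setCK -[U]setCK; exact: subsetC.
by apply: nDx; exact: FD.
Qed.

Lemma coKO_spectrum : is_abstract_spectrum S.
Proof.
split; [by case: coh | exact: coKO_SP1 | exact: coKO_SP2 | left].
by case: coh => _ _ [].
Qed.

End CoherentSpectrum.

(** * Morphisms, the two functors, and their composites *)

Lemma bicontinuous_coherent (S1 S2 : spectrum) (f : S1 -> S2) :
  bicontinuous f ->
  @coherent_map (space (tpos S1)) (space (tpos S2)) f.
Proof.
move=> [fp fn]; split=> // U.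
(* The claim becomes that preimages send [Lpos] into [Lpos], one continuity for each half. *)
rewrite (KO_tpos (spectrumP S1)) (KO_tpos (spectrumP S2)) => -[oU cU]; split.
  by move/continuousP : fp; exact.
by rewrite preimage_setC; move/continuousP : fn; exact.
Qed.

Lemma coherent_bicontinuous (T1 T2 : Type) (t1 : topology T1) (t2 : topology T2)
    (f : T1 -> T2) :
  @coherent_map (space t1) (space t2) f ->
  @bicontinuous (BitopSpace t1 (coKO_topology t1))
    (BitopSpace t2 (coKO_topology t2)) f.
Proof.
move=> [fc fK]; split=> //.
apply/(@continuousP (space (coKO_topology t1)) (space (coKO_topology t2))).
move=> V oV; rewrite open_spaceE => x /oV [U [KU nU UV]].
exists (f @^-1` U); split => //; first exact: fK.
by rewrite preimage_setC; exact: preimage_subset.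
Qed.

Definition spectrum_coh (S : spectrum) : cohSpace :=
  CohSpace (tpos_coherent (spectrumP S)).

Definition spectrum_coh_hom (S1 S2 : spectrum) (f : spectrum_hom S1 S2) :
    coh_hom (spectrum_coh S1) (spectrum_coh S2) :=
  exist _ (sval f) (bicontinuous_coherent (svalP f)).

Definition forgetF : functor AbstractSpectra CohSp.
Proof.
refine (@Functor AbstractSpectra CohSp spectrum_coh spectrum_coh_hom _ _).
- by move=> X; exact: eq_exist.
- by move=> X Y Z g f; exact: eq_exist.
Defined.

Definition coh_spectrum (X : cohSpace) : spectrum :=
  Spectrum (coKO_spectrum (cohSpaceP X)).

Definition coh_spectrum_hom (X Y : cohSpace) (f : coh_hom X Y) :
    spectrum_hom (coh_spectrum X) (coh_spectrum Y) :=
  exist _ (sval f) (coherent_bicontinuous (svalP f)).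

Definition coKOF : functor CohSp AbstractSpectra.
Proof.
refine (@Functor CohSp AbstractSpectra coh_spectrum coh_spectrum_hom _ _).
- by move=> X; exact: eq_exist.
- by move=> X Y Z g f; exact: eq_exist.
Defined.

(* [u] is a faithful functor to types. Equality of carriers is a separate argument
   [eU], so that it can be [erefl] even when the equality of objects [e] is not. *)
Lemma functor_id_ext (C : category) (U : C -> Type)
    (u : forall X Y : C, hom X Y -> U X -> U Y) (F : functor C C)
    (e : forall X, F X = X) (eU : forall X, U (F X) = U X) :
  (forall X Y, injective (@u X Y)) ->
  (forall X Y (f : hom X Y) x,
    u _ _ f (ecast A A (eU X) x) = ecast A A (eU Y) (u _ _ (fhom F f) x)) ->
  F = functor_id C.
Proof.
move=> inju; case: F e eU => o h h1 hM /= e eU uh.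
have o_id : o = id by apply/funext.
move: o_id h h1 hM e eU uh => -> h h1 hM e eU uh.
(* With the object map replaced by [id], [eU X] is a loop, so the casts in [uh] vanish. *)
have eUE X : eU X = erefl by exact: Prop_irrelevance.
have h_id : h = fun _ _ f => f.
  apply: functional_extensionality_dep => X.
  apply: functional_extensionality_dep => Y; apply/funext => f.
  by apply: (inju X Y); apply/funext => x; have := uh X Y f x; rewrite !eUE.
move: h1 hM; rewrite h_id => {uh} h1 hM.
by congr Functor; exact: Prop_irrelevance.
Qed.

Lemma coh_spectrumK (X : cohSpace) : spectrum_coh (coh_spectrum X) = X.
Proof. by case: X => T t p; congr CohSpace; exact: Prop_irrelevance. Qed.

Lemma spectrum_cohK (S : spectrum) : coh_spectrum (spectrum_coh S) = S.
Proof.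
case: S => -[T tp tn] p; rewrite /coh_spectrum /=.
(* The spectrum proof is generalised first, because its type mentions the topology being
   rewritten. *)
move: (coKO_spectrum _); rewrite /= (coKO_tpos p) => q.
by congr Spectrum; exact: Prop_irrelevance.
Qed.

Theorem theorem2p3p11 :
  exists (F : functor AbstractSpectra CohSp) (G : functor CohSp AbstractSpectra),
    functor_comp F G = functor_id CohSp /\
    functor_comp G F = functor_id AbstractSpectra.
Proof.
exists forgetF, coKOF; split.
(* The composites preserve carriers and underlying functions definitionally, so with [erefl] the
   cast condition holds by computation. *)
- apply: (@functor_id_ext CohSp cohpoint (fun X Y f => sval f)
    (functor_comp forgetF coKOF) coh_spectrumK (fun=> erefl)) => //.
  by move=> X Y [f fP] [g gP] /= fg; exact: eq_exist.
- apply: (@functor_id_ext AbstractSpectra bipoint (fun X Y f => sval f)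
    (functor_comp coKOF forgetF) spectrum_cohK (fun=> erefl)) => //.
  by move=> X Y [f fP] [g gP] /= fg; exact: eq_exist.
Qed.
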